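(* There is an absolute constant $C>0$ such that for every odd prime power $q$ we have $$N(q) \le \exp\left(C q^{1/2}\right),$$ where $N(q)$ is the number of pairs $(\mathcal{A},\mathcal{B})$ of subsets $\mathcal{A},\mathcal{B}\subseteq \mathbb{F}_q$ with $\min\{\#\mathcal{A},\#\mathcal{B}\}\ge 2$ and $\mathcal{A}+\mathcal{B}=\mathcal{Q}$, with $\mathcal{Q}=\{x^2 : x\in\mathbb{F}_q^*\}$ the set of nonzero squares (quadratic residues) of $\mathbb{F}_q$.
   Context: $\mathbb{F}_q$ is the finite field with $q$ elements. For $\mathcal{A},\mathcal{B}\subseteq\mathbb{F}_q$, $\mathcal{A}+\mathcal{B}=\{a+b : a\in\mathcal{A},\ b\in\mathcal{B}\}$. A set $\mathcal{S}$ is additively decomposed into $\mathcal{A}$ and $\mathcal{B}$ if $\mathcal{S}=\mathcal{A}+\mathcal{B}$ with $\min\{\#\mathcal{A},\#\mathcal{B}\}\ge 2$. *)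

(* Defs.v *)
From mathcomp Require Import all_boot all_order all_algebra.

Set Implicit Arguments.
Unset Strict Implicit.
Unset Printing Implicit Defensive.

Import GRing.Theory.
Local Open Scope ring_scope.

Definition sumset (F : finFieldType) (A B : {set F}) : {set F} :=
  [set a + b | a in A, b in B].

Definition nonzero_squares (F : finFieldType) : {set F} :=
  [set x ^+ 2 | x : F & x != 0].

Definition additively_decomposed (F : finFieldType) (S A B : {set F}) : bool :=
  (S == sumset A B) && (2 <= minn #|A| #|B|)%N.

(* Ordered pairs: (A, B) and (B, A) are counted separately. *)
Definition num_decompositions (F : finFieldType) : nat :=
  #|[set AB : {set F} * {set F} |
      additively_decomposed (nonzero_squares F) AB.1 AB.2]|.

(* Main.v *)
Require Import Defs.
From mathcomp Require Import all_boot all_order all_algebra.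
From mathcomp Require Import all_solvable all_field.
From mathcomp Require Import reals sequences exp.
From mathcomp Require Import ring zify.

Import Order.TTheory GRing.Theory Num.Theory.
Local Open Scope ring_scope.

(** Let [chi] be the quadratic character of a field with [q] elements and
[A + B] the set of nonzero squares.  Every [b] in [B] satisfies
[chi (b + a) = 1] for all [a] in [A].  Averaging a quartic polynomial in
[sum_(a in A) chi (x + a)] over [x] and using square-root cancellation in the
sums of [chi] over products of at most four linear factors bounds [#|B|] in
terms of [#|A|]; since [#|A| * #|B| >= (q - 1) / 2], this forces
[#|A| >= c sqrt q] (two-element sets [A] are excluded separately, by an isolated
square).  Moreover about [q^(1/4)] elements of [A] already confine [B] to a set
of [O(sqrt q)] elements, so that there are at most
[q^(q^(1/4)) * 2^(O(sqrt q)) = exp (O(sqrt q))] possible [B], and as many [A].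

Quartic sums reduce to cubic ones by inversion.  For a cubic [f], Stepanov's
method applies: a nonzero combination of the [X^i f^(e (q - 1) / 2) X^(q j)]
with [e] in [{0, 1}] is made to vanish to order about [sqrt q] at all points where
[f^((q - 1) / 2)] takes a given value [1] or [-1]; comparing with its degree,
there are at most [q / 2 + O(sqrt q)] such points. *)

(** * Multiplicities and linear algebra *)

(** Supplies the coefficients of Stepanov's auxiliary polynomial: [I] indexes the unknowns, [J] the
    linear conditions imposed on them. *)
Lemma linear_dependency (K : fieldType) (I J : finType) (w : I -> J -> K) :
  (#|J| < #|I|)%N ->
  exists2 c : I -> K, exists i, c i != 0 &
    forall j, \sum_i c i * w i j = 0.
Proof.
move=> ltJI.
pose M := \matrix_(i < #|I|, j < #|J|) w (enum_val i) (enum_val j).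
have : kermx M != 0.
  rewrite -mxrank_eq0 mxrank_ker -lt0n subn_gt0.
  exact: leq_ltn_trans (rank_leq_col M) ltJI.
case/rowV0Pn => v /sub_kermxP vM v0.
exists (fun i => v 0 (enum_rank i)).
  have /existsP[i vi] : [exists i, v 0 i != 0].
    apply: contraNT v0; rewrite negb_exists => /forallP v0.
    by apply/eqP/rowP => i; rewrite mxE; apply/eqP; rewrite -[_ == _]negbK v0.
  by exists (enum_val i); rewrite enum_valK.
move=> j; have := congr1 (fun u : 'rV_#|J| => u 0 (enum_rank j)) vM.
rewrite !mxE => vMj; rewrite -[RHS]vMj (reindex (@enum_val I I)) /=.
  by apply: eq_bigr => i _; rewrite enum_valK !mxE enum_rankK.
by apply: onW_bij; apply: enum_val_bij.
Qed.

Lemma leq_mul_multiplicity (K : fieldType) (p : {poly K}) (rs : seq K) (l : nat) :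
  p != 0 -> uniq rs -> (forall x, x \in rs -> ('X - x%:P) ^+ l %| p) ->
  (l * size rs < size p)%N.
Proof.
move=> p0 urs lp.
have : \prod_(x <- rs) ('X - x%:P) ^+ l %| p.
  elim: rs urs lp => [|x rs IH] /=; first by rewrite big_nil dvd1p.
  case/andP => xrs urs lp; rewrite big_cons Gauss_dvdp.
    rewrite lp ?mem_head // IH // => y yrs.
    by rewrite lp // inE yrs orbT.
  rewrite coprimep_expl // coprimep_sym coprimep_XsubC prodrXl rootE horner_exp.
  apply/negP; rewrite expf_eq0 => /andP[_].
  by rewrite -rootE root_prod_XsubC (negbTE xrs).
move/(dvdp_leq p0); apply: leq_trans; rewrite prodrXl.
have := size_exp (\prod_(x <- rs) ('X - x%:P)) l.
rewrite size_prod_XsubC /= mulnC => <-.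
rewrite prednK // lt0n size_poly_eq0 expf_neq0 //.
by rewrite -size_poly_eq0 size_prod_XsubC.
Qed.

Lemma dvdp_Xn_coef (K : fieldType) (n : nat) (p : {poly K}) :
  (forall i, (i < n)%N -> p`_i = 0) -> 'X^n %| p.
Proof.
move=> p0; rewrite -(poly_take_drop n p) dvdp_addr ?dvdp_mulIr //.
suff -> : take_poly n p = 0 by rewrite dvdp0.
by apply/polyP => i; rewrite coef_take_poly coef0; case: ifP => // /p0.
Qed.

(** The substitution is invertible since [e != 0]: its inverse sends [X] to [(X - x) / e]. *)
Lemma dvdp_XsubC_comp (K : fieldType) (n : nat) (p : {poly K}) (x e : K) :
  e != 0 -> 'X^n %| p \Po (x%:P + e%:P * 'X) -> ('X - x%:P) ^+ n %| p.
Proof.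
move=> e0 /dvdpP[k pk].
have -> : p = (p \Po (x%:P + e%:P * 'X)) \Po (e^-1%:P * ('X - x%:P)).
  rewrite -comp_polyA comp_polyD comp_polyM !comp_polyC comp_polyX.
  by rewrite mulrA -polyCM divff // mul1r addrC subrK comp_polyXr.
rewrite pk comp_polyM rmorphXn /= comp_polyX exprMn mulrA.
exact: dvdp_mull.
Qed.

Lemma poly_Frobenius_card (F : finFieldType) (p q : {poly F}) :
  (p + q) ^+ #|F| = p ^+ #|F| + q ^+ #|F|.
Proof.
apply: exprDn_pchar; have [r r_pr rF] := finPcharP F.
have /abelem_pgroup := fin_ring_pchar_abelem rF.
rewrite /pgroup cardsT; apply: sub_in_pnat => r' _ /eqP ->.
by rewrite pchar_poly.
Qed.

Lemma size_cubic (K : fieldType) (u v w : K) :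
  size ('X^3 + (u *: 'X^2 + v *: 'X + w%:P)) = 4%N.
Proof.
suff le3 : (size (u *: 'X^2 + v *: 'X + w%:P)%R <= 3)%N.
  by rewrite size_polyDl size_polyXn.
rewrite (leq_trans (size_polyD _ _)) // geq_max (leq_trans (size_polyC_leq1 _)) // andbT.
rewrite (leq_trans (size_polyD _ _)) // geq_max.
by rewrite !(leq_trans (size_scale_leq _ _)) ?size_polyXn ?size_polyX.
Qed.

(** * Stepanov's method for cubics *)

Section Stepanov.

Variables (F : finFieldType) (u v w : F).
Hypotheses (oddF : odd #|F|) (w0 : w != 0).
Let q := #|F|.
Let c := q./2.
Let d := (q - 3)./2.
Let f : {poly F} := 'X^3 + (u *: 'X^2 + v *: 'X + w%:P).

Let q_gt2 : (2 < q)%N.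
Proof. by have := finNzRing_gt1 F; move: oddF; rewrite /q; case: #|F| => [|[|[|]]]. Qed.

Let qE : q = c.*2.+1.
Proof. by rewrite -[LHS]odd_double_half [odd q]oddF. Qed.

Let size_f : size f = 4%N. Proof. exact: size_cubic. Qed.

Let f_neq0 : f != 0.
Proof. by rewrite -size_poly_eq0 size_f. Qed.

Let dvdp_Xq_f : 'X^q %| f ^+ q - w%:P.
Proof.
have -> : f = ('X^2 + u *: 'X + v%:P) * 'X + w%:P.
  by rewrite /f -!mul_polyC; ring.
rewrite poly_Frobenius_card -rmorphXn /= expf_card addrK exprMn.
exact: dvdp_mull.
Qed.

(* [(r + s f^c) (r - s f^c) f = r^2 f - s^2 f^q], which is
   [r^2 f - w s^2] mod [X^q]; the degrees of [r^2 f] and [s^2] differ in parity. *)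
Let independent_mod_Xq (r s : {poly F}) : (size r <= d)%N -> (size s <= d)%N ->
  'X^q %| r + s * f ^+ c -> r = 0 /\ s = 0.
Proof.
move=> rd sd Xq.
have dE : (2 * d <= q - 3)%N by rewrite /d; lia.
have E : r ^+ 2 * f - w%:P * s ^+ 2 = 0.
  apply/eqP; apply: contraTT isT => ne0.
  have : 'X^q %| r ^+ 2 * f - w%:P * s ^+ 2.
    have -> : r ^+ 2 * f - w%:P * s ^+ 2
            = (r + s * f ^+ c) * ((r - s * f ^+ c) * f) + s ^+ 2 * (f ^+ q - w%:P).
      have -> : f ^+ q = f * (f ^+ c) ^+ 2 by rewrite -exprM muln2 -exprS -qE.
      by ring.
    by apply: dvdp_add; [apply: dvdp_mulr | apply: dvdp_mull].
  move/(dvdp_leq ne0); rewrite size_polyXn leqNgt ltnS.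
  rewrite (leq_trans (size_polyD _ _)) // geq_max size_polyN.
  rewrite (leq_trans (size_polyMleq _ _)) ?size_f.
    rewrite mul_polyC (leq_trans (size_scale_leq _ _)) //.
    rewrite (leq_trans (size_poly_exp_leq _ _)) //.
    by move: sd dE q_gt2; clear; move: (size s) => n; lia.
  have [-> | r0] := eqVneq r 0; first by rewrite expr0n size_poly0 (leq_trans _ q_gt2).
  have arith a b e k : (0 < b)%N -> (a <= (b.-1 * 2).+1)%N -> (b <= e)%N -> (2 * e <= k - 3)%N ->
      (2 < k)%N -> ((a + 4).-1 <= k)%N by lia.
  apply: arith (size_poly_exp_leq r 2) rd dE q_gt2.
  by rewrite lt0n size_poly_eq0.
have sz2 (p : {poly F}) : p != 0 -> size (p ^+ 2) = ((size p).-1 * 2).+1.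
  move=> p0; rewrite -size_exp prednK // lt0n size_poly_eq0 expf_neq0 //.
have [r0|r0] := eqVneq r 0.
  split=> //; apply/eqP; move/eqP: E; rewrite r0 expr0n mul0r sub0r oppr_eq0.
  by rewrite mulf_eq0 polyC_eq0 (negbTE w0) /= sqrf_eq0.
have [s0|s0] := eqVneq s 0.
  move/eqP: E; rewrite s0 expr0n mulr0 subr0 mulf_eq0 (negbTE f_neq0) orbF.
  by rewrite sqrf_eq0 (negbTE r0).
move/eqP: E; rewrite subr_eq0 => /eqP/(congr1 (fun p : {poly F} => size p)).
rewrite mul_polyC size_scale // size_mul ?expf_neq0 // size_f !sz2 //.
lia.
Qed.

(** Modulo [X^q] only the block [j = 0] survives, so it vanishes by [independent_mod_Xq]; dividing
    by [X^q] shifts the remaining blocks down. *)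
Let independent (J : nat) (r s : nat -> {poly F}) :
  (forall j, (size (r j) <= d)%N) -> (forall j, (size (s j) <= d)%N) ->
  \sum_(j < J) (r j + s j * f ^+ c) * 'X^(q * j) = 0 ->
  forall j, (j < J)%N -> r j = 0 /\ s j = 0.
Proof.
elim: J r s => [//|J IH] r s rd sd.
rewrite big_ord_recl muln0 expr0 mulr1.
under eq_bigr => j _ do rewrite lift0 mulnS exprD mulrCA.
rewrite -mulr_sumr => E.
have [r0 s0] : r 0 = 0 /\ s 0 = 0.
  apply: independent_mod_Xq => //.
  have -> : r 0 + s 0 * f ^+ c
    = - ('X^q * \sum_(i < J) (r i.+1 + s i.+1 * f ^+ c) * 'X^(q * i)).
    by apply/eqP; rewrite -addr_eq0 E.
  by rewrite dvdpNr dvdp_mulr.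
case=> [|j] // jJ; apply: (IH (fun j => r j.+1) (fun j => s j.+1)) => //.
move/eqP: E; rewrite r0 s0 mul0r !add0r mulf_eq0 => /orP[|/eqP //].
by rewrite expf_eq0 polyX_eq0 andbF.
Qed.

(* [U] has weight 2: this bounds the number of linear conditions expressing that
   a combination of the [termE i] below vanishes modulo [U^l]. *)
Let weighted (a : nat) (P : {poly {poly F}}) :=
  forall n, (size (P`_n)%R <= (a + 2 * n).+1)%N.

Let weightedM a b P Q : weighted a P -> weighted b Q -> weighted (a + b) (P * Q).
Proof.
move=> Pa Qb n; rewrite coefM; apply: (leq_trans (size_sum _ _ _)).
apply/bigmax_leqP => i _; apply: (leq_trans (size_polyMleq _ _)).
by have := Pa i; have := Qb (n - i)%N; have := ltn_ord i; lia.
Qed.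

Let weighted1 : weighted 0 1.
Proof. by move=> n; rewrite coef1; case: n => [|n]; rewrite ?size_poly1 ?size_poly0. Qed.

Let weightedX a P k : weighted a P -> weighted (a * k) (P ^+ k).
Proof.
move=> Pa; elim: k => [|k IH]; first by rewrite muln0.
by rewrite exprS mulnS; apply: weightedM.
Qed.

Let weightedC a (p : {poly F}) : (size p <= a.+1)%N -> weighted a p%:P.
Proof.
by move=> pa n; rewrite coefC; case: eqP => [->|_]; rewrite ?size_poly0 ?muln0 ?addn0.
Qed.

Let weightedD a P Q : weighted a P -> weighted a Q -> weighted a (P + Q).
Proof.
move=> Pa Qa n; rewrite coefD (leq_trans (size_polyD _ _)) // geq_max.
by rewrite Pa Qa.
Qed.

Let weightedCXn a (p : {poly F}) n :
  (size p <= (a + 2 * n).+1)%N -> weighted a (p%:P * 'X^n).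
Proof.
move=> pa k; rewrite mul_polyC coefZ coefXn; case: eqP => [->|_].
  by rewrite mulr1.
by rewrite mulr0 size_poly0.
Qed.

(* [f (X + f U) = f * fU_quot], so that, in the variable [U] and after
   specialization of [X] to a point where [f^c] takes the value [eps],
   [f^c] expands as [eps * fU_quot^c]. *)
Let f1 : {poly F} := 3%:R *: 'X^2 + (2%:R * u) *: 'X + v%:P.
Let f2 : {poly F} := 3%:R *: 'X + u%:P.
Let fU_quot : {poly {poly F}} :=
  1 + f1%:P * 'X^1 + (f2 * f)%:P * 'X^2 + (f ^+ 2)%:P * 'X^3.
Let XfU : {poly {poly F}} := 'X%:P + f%:P * 'X^1.

(** The coefficients of [U], [U^2], [U^3] have degrees at most 2, 4, 6. Giving [U] weight 2 thus
    makes the large power [fU_quot^c] cost nothing. *)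
Let weighted_fU_quot : weighted 0 fU_quot.
Proof.
have sf2 : (size f2 <= 2)%N.
  rewrite (leq_trans (size_polyD _ _)) // geq_max (leq_trans (size_polyC_leq1 _)) // andbT.
  by rewrite (leq_trans (size_scale_leq _ _)) ?size_polyX.
do 3 ?apply: weightedD.
- exact: weighted1.
- apply: weightedCXn.
  rewrite (leq_trans (size_polyD _ _)) // geq_max (leq_trans (size_polyC_leq1 _)) // andbT.
  rewrite (leq_trans (size_polyD _ _)) // geq_max.
  by rewrite !(leq_trans (size_scale_leq _ _)) ?size_polyXn ?size_polyX.
- apply: weightedCXn.
  by rewrite (leq_trans (size_polyMleq _ _)) // size_f; lia.
- apply: weightedCXn.
  by rewrite (leq_trans (size_poly_exp_leq _ _)) // size_f.
Qed.

Let weighted_XfU : weighted 1 XfU.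
Proof.
apply: weightedD; first by apply: weightedC; rewrite size_polyX.
by apply: weightedCXn; rewrite size_f.
Qed.

(** * The auxiliary polynomial and its order of vanishing *)

Variables (eps : F) (m : nat).
Hypotheses (eps2 : eps ^+ 2 = 1) (m_large : (12 < m)%N) (mq : (m * m * 4 <= q)%N).
(** [J] is the number of blocks [X^(q j)] and [l] the order of vanishing. There are [2 J d], about
    [q (m + 4)], unknowns and [l (J + d + 2 l)], about [q m + 10 m^2], conditions; [4 m^2 <= q]
    leaves room. *)
Let J := (m + 4)%N.
Let l := (2 * m)%N.

Let idx := (bool * 'I_J * 'I_d)%type.
Let termR (i : idx) : {poly F} :=
  'X^(i.2) * (if i.1.1 then f ^+ c else 1) * 'X^(q * i.1.2).
(** Models [termR i] after [X] is replaced by [X + f U]: at a point [x] one has [x^q = x], so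
    [X^(q j)] becomes [X^j], and this drop in degree keeps the number of conditions small. *)
Let termE (i : idx) : {poly {poly F}} :=
  ('X^(i.1.2))%:P * (XfU ^+ i.2 * (if i.1.1 then eps%:P%:P * fU_quot ^+ c else 1)).

Let weighted_termE i : weighted (J + d) (termE i).
Proof.
have: weighted (i.1.2 + (i.2 + 0)) (termE i).
  apply: weightedM; first by apply: weightedC; rewrite size_polyXn.
  apply: weightedM; first by rewrite -[X in weighted X]mul1n; apply: weightedX.
  case: i.1.1; last exact: weighted1.
  rewrite -[0%N]/(0 + 0)%N; apply: weightedM.
    by apply: weightedC; rewrite size_polyC; case: (eps != 0).
  by rewrite -{1}[0%N](mul0n c); apply: weightedX.
move=> H n; apply: (leq_trans (H n)).
by have := ltn_ord i.1.2; have := ltn_ord i.2; lia.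
Qed.

Let l_le_q : (l <= q)%N.
Proof. by rewrite /l; nia. Qed.

(** The factors [X^i] and [f^c] are matched exactly, the latter because [f(x)^c = eps]. The only
    error is in [X^(q j)]: by Frobenius [y^q] is [x] modulo [X^q], and [l <= q]. *)
Let dvdp_term (x : F) i : f.[x] ^+ c = eps ->
  'X^l %| (termR i \Po (x%:P + f.[x]%:P * 'X)) - map_poly (horner_eval x) (termE i).
Proof.
move=> fx; case: i => [[b j] i]; rewrite /termR /termE /=.
set y := x%:P + _; set e := f.[x].
have XfUE : map_poly (horner_eval x) XfU = y.
  rewrite rmorphD rmorphM /= map_polyX !map_polyC /= /horner_eval hornerX.
  by [].
have fy : f \Po y = e%:P * map_poly (horner_eval x) fU_quot.
  have fyE : f \Po y = y ^+ 3 + (u%:P * y ^+ 2 + v%:P * y + w%:P).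
    by rewrite /f !comp_polyD !comp_polyZ !comp_Xn_poly comp_polyX comp_polyC !mul_polyC.
  have ->  : map_poly (horner_eval x) fU_quot
    = 1 + f1.[x]%:P * 'X + (f2.[x] * e)%:P * 'X^2 + (e ^+ 2)%:P * 'X^3.
    have mapE (a1 a2 a3 : {poly F}) :
        map_poly (horner_eval x) (1 + a1%:P * 'X^1 + a2%:P * 'X^2 + a3%:P * 'X^3)
      = 1 + a1.[x]%:P * 'X + a2.[x]%:P * 'X^2 + a3.[x]%:P * 'X^3.
      by rewrite !rmorphD rmorph1 !(rmorphM _ _%:P) /= !map_polyXn !map_polyC.
    by rewrite mapE hornerM horner_exp.
  have eP : e%:P = x%:P ^+ 3 + (u%:P * x%:P ^+ 2 + v%:P * x%:P + w%:P).
    by rewrite -!rmorphXn -!rmorphM -!rmorphD /=; congr _%:P; rewrite /e /f !hornerE.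
  have f1P : f1.[x]%:P = 3%:R * x%:P ^+ 2 + 2%:R * u%:P * x%:P + v%:P.
    have -> : f1.[x] = 3%:R * x ^+ 2 + 2%:R * u * x + v by rewrite /f1 !hornerE.
    by rewrite !rmorphD (rmorphM _ _ (x ^+ 2)) rmorphXn (rmorphM _ _ x) rmorphM /= !rmorph_nat.
  have f2P : f2.[x]%:P = 3%:R * x%:P + u%:P.
    have -> : f2.[x] = 3%:R * x + u by rewrite /f2 !hornerE.
    by rewrite rmorphD rmorphM /= rmorph_nat.
  rewrite fyE polyCM [(e ^+ 2)%:P]rmorphXn /= f1P f2P /y -/e.
  (* Taylor expansion in generic letters, so that [ring] applies: the constant term is [f(X) = e],
     and every other term already carries a factor [e]. *)
  suff : forall X U V W e T : {poly F}, e = X ^+ 3 + (U * X ^+ 2 + V * X + W) ->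
      (X + e * T) ^+ 3 + (U * (X + e * T) ^+ 2 + V * (X + e * T) + W) =
      e * (1 + (3%:R * X ^+ 2 + 2%:R * U * X + V) * T + (3%:R * X + U) * e * T ^+ 2
           + e ^+ 2 * T ^+ 3) by apply.
  move=> X U V W a T aE.
  rewrite [LHS](_ : _ = X ^+ 3 + (U * X ^+ 2 + V * X + W)
    + a * ((3%:R * X ^+ 2 + 2%:R * U * X + V) * T + (3%:R * X + U) * a * T ^+ 2
           + a ^+ 2 * T ^+ 3)); last by ring.
  by rewrite -aE; ring.
have yq : 'X^l %| y ^+ q - x%:P.
  rewrite /y poly_Frobenius_card -rmorphXn /= expf_card addrC addKr exprMn.
  by apply/dvdp_mull/dvdp_exp2l.
have yqj k : 'X^l %| y ^+ (q * k) - x%:P ^+ k.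
  by rewrite exprM subrXX dvdp_mulr.
have hX : horner_eval x 'X^j = x ^+ j by apply: hornerXn.
rewrite !comp_polyM !comp_Xn_poly rmorphM /= map_polyC /= hX.
rewrite rmorphM !rmorphXn /= XfUE.
have -> : map_poly (horner_eval x) (if b then eps%:P%:P * fU_quot ^+ c else 1)
  = (if b then f ^+ c else 1) \Po y.
  case: b; last by rewrite rmorph1 comp_polyC.
  have hC : horner_eval x eps%:P = eps by apply: hornerC.
  rewrite rmorphM rmorphXn /= map_polyC /= hC.
  have -> : f ^+ c \Po y = (f \Po y) ^+ c by rewrite rmorphXn.
  by rewrite fy exprMn -(rmorphXn _ c e) /= fx.
set g := _ \Po y.
have -> : y ^+ i * g * y ^+ (q * j) - x%:P ^+ j * (y ^+ i * g)
  = y ^+ i * g * (y ^+ (q * j) - x%:P ^+ j).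
  by ring.
exact: dvdp_mull.
Qed.

(** A dependency makes a combination of the [termE i] vanish modulo [U^l] identically in [X]. The
    same combination [p] of the [termR i] is nonzero and vanishes to order [l] at each counted
    point, so [size p] bounds their number. *)
Lemma card_cubic_half_power_lt :
  (l * #|[set x | f.[x] ^+ c == eps]| < q * (J + 1))%N.
Proof.
have eps0 : eps != 0 by apply: contra_eq_neq eps2 => ->; rewrite expr0n eq_sym oner_eq0.
(* By [weighted_termE], [N] bounds the size of every coefficient of [U^k] with [k < l]. *)
pose N := (J + d + 2 * l)%N.
have [|a [i0 ai0] aE] := @linear_dependency F idx ('I_l * 'I_N)%type
    (fun i k => ((termE i)`_k.1)`_k.2).
  rewrite !card_prod !card_ord card_bool /N /J /l /d.
  have := mq; have := m_large; move: (qE) => ->.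
  have -> : ((c.*2.+1 - 3)./2 = c - 1)%N by lia.
  nia.
pose p := \sum_i a i *: termR i.
have p_neq0 : p != 0.
  (* The coefficients are regrouped by block and extended by 0 outside the ordinal ranges, to fit
     [independent]. *)
  pose r b j := \poly_(k < d) (if insub j is Some j' then
     if insub k is Some k' then a (b, j', k') else 0 else 0).
  have pE : p = \sum_(j < J) (r false j + r true j * f ^+ c) * 'X^(q * j).
    have rE b (j : 'I_J) : r b j = \sum_(k < d) a (b, j, k) *: 'X^k.
      rewrite /r poly_def; apply: eq_bigr => k _.
      by rewrite !insubT //= => ?; rewrite /= => ?; congr (a (_, _, _) *: _); apply: val_inj.
    have -> : p = \sum_b \sum_j \sum_k a (b, j, k) *: termR (b, j, k).
      by rewrite /p !pair_bigA /=; apply: eq_bigr => -[[b j] k].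
    rewrite exchange_big /=; apply: eq_bigr => j _.
    rewrite big_bool /= addrC mulrDl !rE !mulr_suml; congr (_ + _).
      by apply: eq_bigr => k _; rewrite /termR /= mulr1 scalerAl.
    by apply: eq_bigr => k _; rewrite /termR /= !scalerAl.
  apply/eqP => p0.
  have sr b j : (size (r b j) <= d)%N by apply: size_poly.
  have := independent J (r false) (r true) (sr false) (sr true) (etrans (esym pE) p0).
  case: i0 ai0 => [[b j] k] abjk /(_ j (ltn_ord j)) [r0 r1].
  have /(congr1 (fun s : {poly F} => s`_k)) : r b j = 0 by case: (b).
  rewrite coef_poly ltn_ord coef0 !insubT //= => ? ?.
  move=> /eqP; apply/negP; apply: contra_neq abjk => <-.
  by congr (a (_, _, _)); apply: val_inj.
have mult x : f.[x] ^+ c = eps -> ('X - x%:P) ^+ l %| p.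
  move=> fx; apply: (@dvdp_XsubC_comp _ _ _ _ f.[x]).
    by apply: contraNneq eps0 => f0; rewrite -fx f0 expr0n; case: (c) qE q_gt2 => // ->.
  (* The errors are divisible by [X^l] by [dvdp_term]; the model sum has no terms below [X^l] by the
     choice of [a]. *)
  have -> : p \Po (x%:P + (f.[x])%:P * 'X)
   = \sum_i a i *: ((termR i \Po (x%:P + f.[x]%:P * 'X)) - map_poly (horner_eval x) (termE i))
     + map_poly (horner_eval x) (\sum_i (a i)%:P%:P * termE i).
    rewrite rmorph_sum rmorph_sum /= -big_split /=; apply: eq_bigr => i _.
    have hC : horner_eval x (a i)%:P = a i by apply: hornerC.
    rewrite comp_polyZ scalerBr (rmorphM _ (a i)%:P%:P) /= map_polyC /= hC.
    by rewrite (mul_polyC (a i)) subrK.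
  apply: dvdp_add.
    apply: (big_ind (fun s : {poly F} => 'X^l %| s)) => [|s t|i _].
    - exact: dvdp0.
    - exact: dvdp_add.
    - by rewrite -mul_polyC dvdp_mull // dvdp_term.
  suff /dvdp_Xn_coef: forall k, (k < l)%N ->
      (map_poly (horner_eval x) (\sum_i (a i)%:P%:P * termE i))`_k = 0 by [].
  move=> k kl; rewrite coef_map /= coef_sum.
  suff -> : \sum_i ((a i)%:P%:P * termE i)`_k = 0 by rewrite /horner_eval horner0.
  apply/polyP => n; rewrite coef0 coef_sum.
  under eq_bigr => i _ do rewrite coefCM coefCM.
  have [nN|nN] := ltnP n N.
    exact: (aE (Ordinal kl, Ordinal nN)).
  apply: big1 => i _; rewrite [X in _ * X]nth_default ?mulr0 //.
  apply: leq_trans (weighted_termE i k) _; apply: leq_trans nN.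
  by rewrite /N; lia.
have := @leq_mul_multiplicity _ p (enum [set x | f.[x] ^+ c == eps]) l p_neq0 (enum_uniq _).
rewrite -cardE => H; apply: leq_trans (H _) _.
  by move=> x; rewrite mem_enum inE => /eqP; apply: mult.
apply: (leq_trans (size_sum _ _ _)); apply/bigmax_leqP => i _.
apply: (leq_trans (size_scale_leq _ _)).
apply: (leq_trans (size_polyMleq _ _)); rewrite size_polyXn.
have sg : (size (if i.1.1 then f ^+ c else 1%R) <= 3 * c + 1)%N.
  case: i.1.1; last by rewrite size_poly1; lia.
  by apply: leq_trans (size_poly_exp_leq _ _) _; rewrite size_f addn1.
have sXg := size_polyMleq 'X^(i.2) (if i.1.1 then f ^+ c else 1%R).
have dE : (2 * d <= q - 3)%N by rewrite /d; lia.
rewrite size_polyXn in sXg.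
(* Degrees are below [d + 3 c + q (J - 1)], and [d + 3 c < 2 q]. *)
have arith (A B j k J' d' c' q' : nat) : (A <= (k.+1 + B).-1 -> B <= 3 * c' + 1 ->
  j < J' -> k < d' -> 2 * d' <= q' - 3 -> q' = c'.*2.+1 ->
  (A + (q' * j).+1).-1 <= q' * (J' + 1))%N by nia.
exact: arith sXg sg (ltn_ord i.1.2) (ltn_ord i.2) dE qE.
Qed.

End Stepanov.

(** * The quadratic character *)

(** Defined by Euler's criterion, so that Stepanov's count of the points where [f^c] is 1 or -1
    applies directly; [mem_nonzero_squares] links it to squares. *)
Definition chi (F : finFieldType) (x : F) : int :=
  if x == 0 then 0 else if x ^+ (#|F|./2) == 1 then 1 else -1.

Section QuadraticCharacter.

Variables (F : finFieldType).
Hypothesis oddF : odd #|F|.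
Implicit Types (x y : F).
Let c := #|F|./2.

Lemma card_odd_field : #|F| = c.*2.+1.
Proof. by rewrite -[LHS]odd_double_half oddF. Qed.

Lemma half_card_gt0 : (0 < c)%N.
Proof. by have := finNzRing_gt1 F; rewrite card_odd_field; case: c. Qed.

Lemma half_power_sign x : x != 0 -> (x ^+ c == 1) || (x ^+ c == -1).
Proof.
move=> x0; rewrite -sqrf_eq1 -exprM muln2.
apply/eqP/(mulfI x0); rewrite mulr1 -exprS -card_odd_field.
exact: expf_card.
Qed.

Lemma leq_card_half_power_eq1 : (#|[set x | x ^+ c == 1%R :> F]| <= c)%N.
Proof.
rewrite cardE; apply: max_unity_roots; rewrite ?enum_uniq ?half_card_gt0 //.
by apply/allP => x; rewrite mem_enum inE unity_rootE.
Qed.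

Lemma card_nonzero : #|[set x : F | x != 0%R]| = c.*2.
Proof.
have := cardsC [set (0 : F)]; rewrite cards1 card_odd_field => -[<-].
by apply: eq_card => x; rewrite !inE.
Qed.

(** Otherwise all [2 c] nonzero elements would be roots of [X^c - 1]. *)
Lemma oner_neqN1 : (1 : F) != -1.
Proof.
apply/negP => /eqP e1; have := leq_card_half_power_eq1; rewrite leqNgt => /negP[].
rewrite (@leq_trans c.*2) //; first by rewrite -addnn -[ltnLHS]addn0 ltn_add2l half_card_gt0.
rewrite -card_nonzero subset_leq_card //; apply/subsetP => x; rewrite !inE => x0.
by have := half_power_sign x x0; rewrite -e1 orbb.
Qed.

Lemma chi0 : chi F 0 = 0.
Proof. by rewrite /chi eqxx. Qed.

Lemma chi_eq0 x : (chi F x == 0) = (x == 0).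
Proof. by rewrite /chi; case: (x == 0) => //; case: ifP. Qed.

Lemma chi_intr x : (chi F x)%:~R = x ^+ c.
Proof.
rewrite /chi; case: eqVneq => [->|x0].
  by rewrite expr0n; case: (c) half_card_gt0.
case: eqVneq => [->//|x1].
by have := half_power_sign x x0; rewrite (negbTE x1) => /eqP ->.
Qed.

Lemma chi_cases x : [\/ chi F x = 0, chi F x = 1 | chi F x = -1].
Proof.
rewrite /chi; case: ifP => _; first by constructor 1.
by case: ifP => _; [constructor 2 | constructor 3].
Qed.

(** The values 0, 1, -1 remain distinct in [F], where [chi] becomes the multiplicative map [x^c]. *)
Lemma chiM x y : chi F (x * y) = chi F x * chi F y.
Proof.
have inj (i j : int) : [\/ i = 0, i = 1 | i = -1] -> [\/ j = 0, j = 1 | j = -1] ->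
    i%:~R = j%:~R :> F -> i = j.
  have e := negbTE oner_neqN1; have z := negbTE (oner_neq0 F).
  have zN : (0 == -1 :> F) = false by rewrite eq_sym oppr_eq0 z.
  by move=> [] -> [] -> //; rewrite ?(rmorph0, rmorphN, rmorph1) => /eqP;
    rewrite ?zN ?oppr_eq0 ?z ?e // eq_sym ?z ?e.
apply: inj; first exact: chi_cases.
  by have [->|->|->] := chi_cases x; have [->|->|->] := chi_cases y;

    [constructor 1|constructor 1|constructor 1|constructor 1|constructor 2|constructor 3
    |constructor 1|constructor 3|constructor 2].
by rewrite rmorphM /= !chi_intr exprMn.
Qed.

Lemma chi1 : chi F 1 = 1.
Proof. by rewrite /chi oner_eq0 expr1n eqxx. Qed.

Lemma chi_mulrr x : chi F x * chi F x = (x != 0)%:R.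
Proof.
case: eqVneq => [->|x0]; first by rewrite chi0.
by have := chi_eq0 x; have [->|->|->] := chi_cases x; rewrite (negbTE x0).
Qed.

Lemma chi_sqr x : x != 0 -> chi F (x ^+ 2) = 1.
Proof. by move=> x0; rewrite expr2 chiM chi_mulrr x0. Qed.

Lemma normr_chi x : `|chi F x| <= 1.
Proof. by have [->|->|->] := chi_cases x. Qed.

Lemma leq_card_nonzero_squares : (c <= #|nonzero_squares F|)%N.
Proof.
rewrite -leq_double -card_nonzero -sum1_card.
rewrite (partition_big (fun x => x ^+ 2) [in nonzero_squares F]) /=; last first.
  by move=> x; rewrite inE => x0; apply/imsetP; exists x; rewrite ?inE.
rewrite -muln2 -sum_nat_const; apply: leq_sum => y /imsetP[x x0 ->].
rewrite sum1_card; apply: (@leq_trans #|[set x; - x]|); last by rewrite cards2; case: eqP.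
apply: subset_leq_card; apply/subsetP => z.
by rewrite !inE => /andP[_]; rewrite eqf_sqr.
Qed.

(** The squares lie among the at most [c] roots of [X^c - 1], and there are at least [c] of them. *)
Lemma mem_nonzero_squares x : (x \in nonzero_squares F) = (chi F x == 1).
Proof.
have sub : nonzero_squares F \subset [set y | y ^+ c == 1%R :> F].
  apply/subsetP => _ /imsetP[y y0 ->]; rewrite !inE in y0 *.
  by rewrite -chi_intr chi_sqr.
have -> : nonzero_squares F = [set y | y ^+ c == 1%R :> F].
  apply/eqP; rewrite eqEcard sub.
  exact: leq_trans leq_card_half_power_eq1 leq_card_nonzero_squares.
rewrite inE /chi; have [->|x0] := eqVneq x 0; last by case: ifP.
by rewrite expr0n; case: (c) half_card_gt0 => //= *; rewrite eq_sym oner_eq0.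
Qed.

(** Multiplication by a nonresidue permutes [F] and negates the sum. *)
Lemma sum_chi : \sum_x chi F x = 0.
Proof.
have [y y0 yN] : exists2 y, y != 0 & chi F y = -1.
  have : ~~ ([set y : F | y != 0] \subset [set x | x ^+ c == 1%R :> F]).
    apply/negP => /subset_leq_card; rewrite card_nonzero.
    move/leq_trans/(_ leq_card_half_power_eq1); rewrite -addnn -[leqRHS]addn0.
    by rewrite leq_add2l leqNgt half_card_gt0.
  case/subsetPn => y; rewrite !inE => y0 y1; exists y => //.
  by rewrite /chi (negbTE y0) (negbTE y1).
have : \sum_x chi F x = - \sum_x chi F x.
  rewrite -sumrN (reindex_inj (mulfI y0)) /=.
  by apply: eq_bigr => x _; rewrite chiM yN mulN1r.
by lia.
Qed.

Lemma sum_chiD a : \sum_x chi F (x + a) = 0.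
Proof. by rewrite -[RHS]sum_chi [RHS](reindex_inj (addIr a)). Qed.

Lemma normr_sum_chi_le_card (I : finType) (P : pred I) (g : I -> F) :
  `|\sum_(i | P i) chi F (g i)| <= #|I|%:R.
Proof.
apply: le_trans (ler_norm_sum _ _ _) _; rewrite -sumr_const big_mkcond /=.
by apply: ler_sum => i _; case: ifP => // _; apply: normr_chi.
Qed.

End QuadraticCharacter.

(** * Square-root bound for cubic character sums *)

Section CubicSum.

Variables (F : finFieldType) (s : nat).
Hypotheses (oddF : odd #|F|) (sF : (s * s <= #|F|)%N) (Fs : (#|F| < s.+1 * s.+1)%N).
Let c := #|F|./2.

Let s_gt0 : (0 < s)%N.
Proof. by have := finNzRing_gt1 F; move: Fs; case: s => //; case: #|F| => [|[]]. Qed.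

(** The sum is [#|S 1| - #|S (-1)|]. Both counts are at most [q / 2 + O(s)], and together they miss
    at most 3 points, so each upper bound yields a lower bound for the other. *)
Let cubic_sum_bound0 (u v w : F) : w != 0 ->
  `|\sum_x chi F (x ^+ 3 + (u * x ^+ 2 + v * x + w))| <= 100 * s%:R.
Proof.
move=> w0; set g := fun x => x ^+ 3 + (u * x ^+ 2 + v * x + w).
(* For small [s] the trivial bound [q] suffices; otherwise [m = s / 2] exceeds 12. *)
have [s_lt|s_ge] := ltnP s 26.
  apply: le_trans (normr_sum_chi_le_card _ _ _ _) _.
  rewrite -[100]/(100%:R) -natrM ler_nat; apply: leq_trans (ltnW Fs) _.
  have : (s * s <= 25 * s)%N by rewrite leq_mul2r -ltnS s_lt orbT.
  by move: s_gt0; rewrite mulSn mulnS; lia.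
pose f : {poly F} := 'X^3 + (u *: 'X^2 + v *: 'X + w%:P).
have fg x : f.[x] = g x by rewrite /f /g !hornerE.
pose m := s./2.
have m_gt : (12 < m)%N by rewrite /m; lia.
have mF : (m * m * 4 <= #|F|)%N by apply: leq_trans sF; rewrite /m; nia.
pose S (e : F) := [set x | g x ^+ c == e].
have card_S e : e ^+ 2 = 1 -> (2 * m * #|S e| < #|F| * (m + 4 + 1))%N.
  move=> e2; have := @card_cubic_half_power_lt F u v w oddF w0 e m e2 m_gt mF.
  suff -> : [set x | f.[x] ^+ c == e] = S e by [].
  by apply/setP => x; rewrite !inE fg.
have card0 : (#|[set x | g x == 0%R]| < 4)%N.
  have f3 : size f = 4%N := size_cubic _ u v w.
  rewrite -f3 cardE; apply: max_poly_roots; rewrite ?enum_uniq //.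
    by rewrite -size_poly_eq0 f3.
  by apply/allP => x; rewrite mem_enum inE rootE fg.
have sumE : \sum_x chi F (g x) = #|S 1|%:R - #|S (-1)|%:R.
  have cardE' (A : {set F}) : #|A|%:R = \sum_x (x \in A)%:R :> int.
    by rewrite -sum1_card natr_sum big_mkcond; apply: eq_bigr => x _; case: (x \in A).
  rewrite !cardE' -sumrB; apply: eq_bigr => x _; rewrite !inE -chi_intr //.
  have := oner_neqN1 F oddF; have := oner_neq0 F.
  by have [->|->|->] := chi_cases F (g x) => z e;
    rewrite /= ?eqxx ?(negbTE z) ?[_ == 1]eq_sym ?(negbTE z) ?(negbTE e)
      ?[0 == _]eq_sym ?oppr_eq0 ?(negbTE z).
have cover : (#|F| <= #|S 1%R| + #|S (-1)%R| + #|[set x | g x == 0%R]|)%N.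
  rewrite -cardsT.
  apply: (@leq_trans #|S 1 :|: S (-1) :|: [set x | g x == 0%R]|).
    apply: subset_leq_card; apply/subsetP => x _; rewrite !inE.
    by have [_|gx] := eqVneq (g x) 0; rewrite ?orbT // half_power_sign.
  apply: leq_trans (leq_card_setU _ _) _; rewrite leq_add2r.
  exact: leq_card_setU.
have := card_S 1 (expr1n _ 2); have := card_S (-1) (etrans (sqrrN 1) (expr1n _ 2)).
move: card0 cover sumE; move: #|S 1| #|S (-1)| #|[set x | g x == 0%R]| => a b z.
move=> z4 cover -> hb ha.
have hs : (s <= 2 * m + 1)%N by rewrite /m; lia.
have hs' : (2 * m <= s)%N by rewrite /m; lia.
(* Bounds the excess [5 q / (2 m)] over [q / 2] in [card_S]. *)
have bnd : (5 * #|F| <= (20 * m + 45) * m)%N by move: Fs hs m_gt; nia.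
have [ab ba] : (a <= b + 100 * s)%N /\ (b <= a + 100 * s)%N.
  by split; move: ha hb cover z4 bnd hs' m_gt; nia.
by move: ab ba; lia.
Qed.

(** Translation by a point [t] where the cubic is nonzero makes its value there the constant term;
    if there is no such [t], every summand is 0. *)
Lemma cubic_sum_bound (u v w : F) :
  `|\sum_x chi F (x ^+ 3 + (u * x ^+ 2 + v * x + w))| <= 100 * s%:R.
Proof.
have [/existsP[t]|] := boolP [exists t, t ^+ 3 + (u * t ^+ 2 + v * t + w) != 0].
  move=> t0; rewrite (reindex_inj (addrI t)) /=.
  have := @cubic_sum_bound0 (3%:R * t + u) (3%:R * t ^+ 2 + 2%:R * u * t + v) _ t0.
  by congr (`|_| <= _); apply: eq_bigr => x _; congr chi; ring.
rewrite negb_exists => /forallP t0.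
rewrite big1 ?normr0 ?mulr_ge0 // => x _.
by have := t0 x; rewrite negbK => /eqP ->; rewrite chi0.
Qed.

End CubicSum.

(** * Character sums over products of linear factors *)

Section CharacterSums.

Variables (F : finFieldType) (E : int).
Hypotheses (oddF : odd #|F|) (E_ge1 : 1 <= E).
Hypothesis cubic_le : forall u v w : F,
  `|\sum_x chi F (x ^+ 3 + (u * x ^+ 2 + v * x + w))| <= E.
Implicit Types (a b c d : F) (A B : {set F}).
Let q : int := #|F|%:R.

Lemma sum_chi_inv (g : F -> F) :
  \sum_(x | x != 0) chi F (g x^-1) = \sum_x chi F (g x) - chi F (g 0).
Proof.
rewrite [in RHS](bigD1 0) //= [X in _ = X - _]addrC addrK [RHS](reindex_inj invr_inj) /=.
by apply: eq_bigl => x; rewrite invr_eq0.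
Qed.

(** After a shift, dividing by the square [x^2] and inverting [x] leave a complete linear sum, which
    is 0, minus its term [chi 1] at 0. *)
Lemma sum_chi2 a b : a != b -> \sum_x chi F ((x + a) * (x + b)) = -1.
Proof.
move=> ab; have e0 : a - b != 0 by rewrite subr_eq0.
rewrite (reindex_inj (addIr (- b))) /= (bigD1 0) //= subrK mulr0 chi0 add0r.
transitivity (\sum_(x | x != 0) chi F (1 + (a - b) * x^-1)).
  apply: eq_bigr => x x0.
  rewrite -[RHS]mul1r -(chi_sqr _ oddF _ x0) -chiM //; congr chi.
  by field.
rewrite (sum_chi_inv (fun x => 1 + (a - b) * x)) mulr0 addr0 chi1.
suff -> : \sum_x chi F (1 + (a - b) * x) = 0 by [].
by rewrite -[RHS](sum_chi _ oddF) [RHS](reindex_inj (inj_comp (addrI 1) (mulfI e0))).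
Qed.

Lemma sum_chi3_le a b c : `|\sum_x chi F ((x + a) * (x + b) * (x + c))| <= E.
Proof.
have := cubic_le (a + b + c) (a * b + a * c + b * c) (a * b * c).
by congr (`|_| <= _); apply: eq_bigr => x _; congr chi; ring.
Qed.

(** Shifting the root [-d] to 0, dividing by [x^4] and inverting [x] turn the quartic into a cubic;
    the omitted term at 0 accounts for the [+ 1]. *)
Lemma sum_chi4_le_distinct a b c d : d != a -> d != b -> d != c ->
  \sum_x chi F ((x + a) * (x + b) * (x + c) * (x + d)) <= E + 1.
Proof.
move=> da db dc.
have a0 : a - d != 0 by rewrite subr_eq0 eq_sym.
have b0 : b - d != 0 by rewrite subr_eq0 eq_sym.
have c0 : c - d != 0 by rewrite subr_eq0 eq_sym.
rewrite (reindex_inj (addIr (- d))) /= (bigD1 0) //= subrK mulr0 chi0 add0r.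
pose g x := (1 + (a - d) * x) * (1 + (b - d) * x) * (1 + (c - d) * x).
have -> : \sum_(x | x != 0) chi F ((x - d + a) * (x - d + b) * (x - d + c) * (x - d + d))
  = \sum_(x | x != 0) chi F (g x^-1).
  apply: eq_bigr => x x0; have x20 : x ^+ 2 != 0 by rewrite expf_neq0.
  rewrite -[RHS]mul1r -(chi_sqr _ oddF _ x20) -chiM //; congr chi.
  by rewrite /g; field.
rewrite sum_chi_inv /g !mulr0 !addr0 !mulr1 chi1.
have -> : \sum_x chi F ((1 + (a - d) * x) * (1 + (b - d) * x) * (1 + (c - d) * x))
  = chi F ((a - d) * (b - d) * (c - d)) *
    \sum_x chi F ((x + (a - d)^-1) * (x + (b - d)^-1) * (x + (c - d)^-1)).
  rewrite mulr_sumr; apply: eq_bigr => x _; rewrite -chiM //; congr chi.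
  by field; rewrite a0 b0 c0.
apply: le_trans (ler_norm _) _; apply: le_trans (ler_normB _ _) _.
rewrite normrM normr1 lerD2r.
have := ler_pM (normr_ge0 _) (normr_ge0 _) (normr_chi _ ((a - d) * (b - d) * (c - d)))
  (sum_chi3_le (a - d)^-1 (b - d)^-1 (c - d)^-1).
by rewrite mul1r.
Qed.

(** Indicator that the four shifts split into two equal pairs; the factors [a != b] make the three
    pairings disjoint. *)
Let paired a b c d : int :=
  (a == b)%:R * (c == d)%:R + (a != b)%:R * ((a == c)%:R * (b == d)%:R)
  + (a != b)%:R * ((a == d)%:R * (b == c)%:R).

(** Either some shift differs from the other three and the previous bound applies, or the shifts
    pair up and the trivial bound [q] is used. *)
Let sum_chi4_le a b c d :
  \sum_x chi F ((x + a) * (x + b) * (x + c) * (x + d)) <= q * paired a b c d + (E + 1).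
Proof.
have q0 : 0 <= q by rewrite /q.
have p0 : 0 <= paired a b c d by rewrite !addr_ge0 // !mulr_ge0.
have ge_E1 (t : int) : t <= E + 1 -> t <= q * paired a b c d + (E + 1).
  by move=> /le_trans; apply; rewrite lerDr mulr_ge0.
have [/and3P[da db dc]|nd] := boolP [&& d != a, d != b & d != c].
  exact/ge_E1/sum_chi4_le_distinct.
have permE (g : F -> F) : (forall x, (x + a) * (x + b) * (x + c) * (x + d) = g x) ->
    \sum_x chi F ((x + a) * (x + b) * (x + c) * (x + d)) = \sum_x chi F (g x).
  by move=> gE; apply: eq_bigr => x _; rewrite gE.
have [/and3P[ca cb cd]|nc] := boolP [&& c != a, c != b & c != d].
  apply: ge_E1; rewrite (permE (fun x => (x + a) * (x + b) * (x + d) * (x + c))).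
    exact: sum_chi4_le_distinct.
  by move=> x; ring.
have [/and3P[bd bc ba]|nb] := boolP [&& b != d, b != c & b != a].
  apply: ge_E1; rewrite (permE (fun x => (x + d) * (x + c) * (x + a) * (x + b))).
    exact: sum_chi4_le_distinct.
  by move=> x; ring.
have [/and3P[ad ac ab]|na] := boolP [&& a != d, a != c & a != b].
  apply: ge_E1; rewrite (permE (fun x => (x + d) * (x + c) * (x + b) * (x + a))).
    exact: sum_chi4_le_distinct.
  by move=> x; ring.
suff p1 : paired a b c d = 1.
  rewrite p1 mulr1; apply: (@le_trans _ _ q); last first.
    by rewrite lerDl addr_ge0 // (le_trans ler01 E_ge1).
  by apply: le_trans (ler_norm _) _; apply: normr_sum_chi_le_card.
rewrite /paired; have [ab|ab] := eqVneq a b.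
  rewrite -{}ab in nd nc *; have [_|cd] := eqVneq c d.
    by rewrite /= !mul0r !addr0 mul1r.
  move: nd nc; rewrite eq_sym [d == c]eq_sym (negbTE cd) /= !andbT !andbb !negbK.
  by move=> /eqP ad /eqP ca; case/eqP: cd; rewrite ca ad.
have [ac|ac] := eqVneq a c.
  move: nb; rewrite -ac [b == a]eq_sym (negbTE ab) /= andbT negbK => /eqP <-.
  by rewrite eqxx /= mul0r mulr0 !mul1r addr0.
move: na; rewrite (negbTE ab) ac /= !andbT negbK => /eqP ad.
move: nb; rewrite -ad [b == a]eq_sym (negbTE ab) /= andbT negbK => /eqP ->.
by rewrite !eqxx /= !mul0r !mulr0 !mul1r.
Qed.

Let sum_const A (t : int) : \sum_(a in A) t = t * #|A|%:R.
Proof. by rewrite sumr_const mulr_natr. Qed.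

Let sum_eq_mem A a : a \in A -> \sum_(b in A) (a == b)%:R = 1 :> int.
Proof.
move=> aA; rewrite (bigD1 a) //= eqxx big1 ?addr0 // => b /andP[_ ba].
by rewrite eq_sym (negbTE ba).
Qed.

Let sum_paired A : \sum_(a in A) \sum_(b in A) \sum_(c in A) \sum_(d in A) paired a b c d
  = 3%:R * #|A|%:R ^+ 2 - 2%:R * #|A|%:R.
Proof.
set k : int := #|A|%:R.
have sum1 : \sum_(a in A) 1 = k by rewrite sumr_const.
have sum2 : \sum_(a in A) \sum_(b in A) (a != b)%:R = k ^+ 2 - k.
  under eq_bigr => a aA.
    rewrite (eq_bigr (fun b => 1 - (a == b)%:R)); last by move=> b _; case: (a == b).
    rewrite sumrB sum1 sum_eq_mem //.
    over.
  by rewrite sumrB sum1 sumr_const -mulr_natr expr2.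
transitivity (\sum_(a in A) \sum_(b in A) \sum_(c in A)
    ((a == b)%:R + (a != b)%:R * (a == c)%:R + (a != b)%:R * (b == c)%:R) : int).
  apply: eq_bigr => a aA; apply: eq_bigr => b bA; apply: eq_bigr => c cA.
  rewrite !big_split /= -!mulr_sumr -mulr_suml !sum_eq_mem //.
  by rewrite !mulr1 mul1r.
transitivity (\sum_(a in A) \sum_(b in A) ((a == b)%:R * k + (a != b)%:R + (a != b)%:R)).
  apply: eq_bigr => a aA; apply: eq_bigr => b bA.
  by rewrite !big_split /= -!mulr_sumr !sum_eq_mem // !mulr1 sumr_const mulr_natr.
under eq_bigr => a aA do rewrite !big_split /= -mulr_suml sum_eq_mem // mul1r.
by rewrite !big_split /= sum2 sumr_const -mulr_natr -/k; ring.
Qed.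

(** * Moments of the shifted character sums *)

Let root_sum A (x : F) : int := \sum_(a in A) chi F (x + a).

(** Diagonal pairs contribute at most [q] each, the others -1. *)
Let sum_root_sum2 A : \sum_x root_sum A x ^+ 2 <= q * #|A|%:R.
Proof.
under eq_bigr => x _ do rewrite expr2 big_distrlr /=.
rewrite exchange_big /=.
have -> : q * #|A|%:R = \sum_(a in A) \sum_(b in A) q * (a == b)%:R.
  under eq_bigr => a aA do rewrite -mulr_sumr sum_eq_mem // mulr1.
  by rewrite sumr_const mulr_natr.
apply: ler_sum => a aA; rewrite exchange_big /=; apply: ler_sum => b bA.
under eq_bigr => x _ do rewrite -chiM //.
have [<-|ab] := eqVneq a b; last by rewrite sum_chi2 // mulr0.
rewrite mulr1; apply: le_trans (ler_norm _) _; exact: normr_sum_chi_le_card.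
Qed.

Let sum_root_sum3 A : \sum_x root_sum A x ^+ 3 <= E * #|A|%:R ^+ 3.
Proof.
have -> : \sum_x root_sum A x ^+ 3 =
    \sum_(a in A) \sum_(b in A) \sum_(c in A) \sum_x chi F ((x + a) * (x + b) * (x + c)).
  transitivity (\sum_x \sum_(a in A) \sum_(b in A) \sum_(c in A)
      chi F ((x + a) * (x + b) * (x + c))).
    apply: eq_bigr => x _; rewrite exprSr expr2 big_distrlr /= mulr_suml.
    apply: eq_bigr => a _; rewrite mulr_suml; apply: eq_bigr => b _.
    by rewrite mulr_sumr; apply: eq_bigr => c _; rewrite !chiM.
  rewrite exchange_big; apply: eq_bigr => a _; rewrite exchange_big.
  by apply: eq_bigr => b _; rewrite exchange_big.
have -> : E * #|A|%:R ^+ 3 = \sum_(a in A) \sum_(b in A) \sum_(c in A) E.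
  by rewrite !sum_const; ring.
do 3 (apply: ler_sum => ? _).
exact: le_trans (ler_norm _) (sum_chi3_le _ _ _).
Qed.

Let sum_root_sum4 A : \sum_x root_sum A x ^+ 4 <=
  q * (3%:R * #|A|%:R ^+ 2 - 2%:R * #|A|%:R) + (E + 1) * #|A|%:R ^+ 4.
Proof.
have -> : \sum_x root_sum A x ^+ 4 =
    \sum_(a in A) \sum_(b in A) \sum_(c in A) \sum_(d in A)
      \sum_x chi F ((x + a) * (x + b) * (x + c) * (x + d)).
  transitivity (\sum_x \sum_(a in A) \sum_(b in A) \sum_(c in A) \sum_(d in A)
      chi F ((x + a) * (x + b) * (x + c) * (x + d))).
    apply: eq_bigr => x _; rewrite 2!exprSr expr2 big_distrlr /= !mulr_suml.
    apply: eq_bigr => a _; rewrite !mulr_suml; apply: eq_bigr => b _.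
    rewrite [X in X * _]mulr_sumr mulr_suml; apply: eq_bigr => c _; rewrite mulr_sumr.
    by apply: eq_bigr => d _; rewrite !chiM.
  rewrite exchange_big; apply: eq_bigr => a _; rewrite exchange_big.
  apply: eq_bigr => b _; rewrite exchange_big.
  by apply: eq_bigr => c _; rewrite exchange_big.
have -> : (E + 1) * #|A|%:R ^+ 4
  = \sum_(a in A) \sum_(b in A) \sum_(c in A) \sum_(d in A) (E + 1).
  by rewrite !sum_const; ring.
rewrite -sum_paired mulr_sumr -big_split; apply: ler_sum => a _ /=.
rewrite mulr_sumr -big_split; apply: ler_sum => b _ /=.
rewrite mulr_sumr -big_split; apply: ler_sum => c _ /=.
rewrite mulr_sumr -big_split; apply: ler_sum => d _ /=.
exact: sum_chi4_le.
Qed.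

(* The test function [(y^2 + 2y)^2] of [y = sum_(a in A) chi (x + a)]: at the
   points of [B] it takes its maximal value, while its average is so small that,
   for [3 <= #|A| <= c sqrt q], the resulting upper bound on [#|B|] falls below
   [(q - 1) / (2 #|A|)]. *)
Lemma card_common_residues A B :
  (forall a b, a \in A -> b \in B -> chi F (b + a) = 1) -> (0 < #|A|)%N ->
  #|B|%:R * (#|A|%:R * (#|A|%:R + 2%:R) ^+ 2)
    <= q * (3%:R * #|A|%:R + 2%:R) + 6%:R * E * #|A|%:R ^+ 3.
Proof.
move=> AB A0; set k : int := #|A|%:R.
have k1 : 1 <= k by rewrite /k ler1n.
have le4 := sum_root_sum4 A; have le3 := sum_root_sum3 A; have le2 := sum_root_sum2 A.
rewrite -/k in le4 le3 le2.
have leB : #|B|%:R * (k ^+ 2 + 2%:R * k) ^+ 2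
    <= \sum_x (root_sum A x ^+ 2 + 2%:R * root_sum A x) ^+ 2.
  rewrite mulrC -sum_const big_mkcond /=.
  apply: ler_sum => x _; case: ifP => xB; last exact: sqr_ge0.
  suff -> : root_sum A x = k by [].
  by rewrite /root_sum (eq_bigr (fun=> 1)) ?sumr_const // => a aA; apply: AB.
have : \sum_x (root_sum A x ^+ 2 + 2%:R * root_sum A x) ^+ 2
  = \sum_x root_sum A x ^+ 4 + 4%:R * \sum_x root_sum A x ^+ 3
    + 4%:R * \sum_x root_sum A x ^+ 2.
  by rewrite !mulr_sumr -!big_split; apply: eq_bigr => x _ /=; ring.
move=> sumE; rewrite sumE in leB.
have leB' : #|B|%:R * (k ^+ 2 + 2%:R * k) ^+ 2 <= q * (3%:R * k ^+ 2 - 2%:R * k)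
    + (E + 1) * k ^+ 4 + 4%:R * (E * k ^+ 3) + 4%:R * (q * k).
  by lia.
(* After multiplication by [k], the error [(E + 1) k^4 + 4 E k^3] is absorbed into [6 E k^4]. *)
rewrite -(ler_pM2l (lt_le_trans ltr01 k1)).
have : E * k ^+ 3 <= E * k ^+ 4 by rewrite ler_wpM2l ?ler_weXn2l //; lia.
have : k ^+ 4 <= E * k ^+ 4 by rewrite ler_peMl // exprn_ge0 //; lia.
set K4 := k ^+ 4; set EK3 := E * k ^+ 3; set EK4 := E * K4 => h1 h2.
have -> : k * (#|B|%:R * (k * (k + 2%:R) ^+ 2)) = #|B|%:R * (k ^+ 2 + 2%:R * k) ^+ 2 by ring.
apply: le_trans leB' _.
have -> : k * (q * (3%:R * k + 2%:R) + 6%:R * E * k ^+ 3)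
  = q * (3%:R * k ^+ 2 - 2%:R * k) + 4%:R * (q * k) + 6%:R * EK4 by rewrite /EK4 /K4; ring.
rewrite mulrDl mul1r -/EK4; lia.
Qed.

(** The weight [g] below has sum at least [q + 1 - E]. Without such an [x] it would be positive only
    at 0, [d] and [-d], with values at most 8. *)
Lemma exists_isolated_residue d : d != 0 -> E + 24 <= q ->
  exists x, [/\ chi F x = 1, chi F (x + d) = -1 & chi F (x - d) = -1].
Proof.
move=> d0 Eq.
have d2 : d != - d.
  rewrite -addr_eq0 -mulr2n -mulr_natl mulf_neq0 //.
  by rewrite -[2%:R]/(1 + 1) addr_eq0 oner_neqN1.
have [z1 z2] : 0 != d /\ 0 != - d by rewrite ![0 == _]eq_sym oppr_eq0.
pose g x : int := (1 + chi F x) * (1 - chi F (x + d)) * (1 - chi F (x - d)).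
have sum_g : 24 < \sum_x g x.
  have -> : \sum_x g x = \sum_(x : F) 1 + \sum_x chi F (x + 0) - \sum_x chi F (x + d)
      - \sum_x chi F (x + - d) - \sum_x chi F ((x + 0) * (x + d))
      - \sum_x chi F ((x + 0) * (x + - d)) + \sum_x chi F ((x + d) * (x + - d))
      + \sum_x chi F ((x + 0) * (x + d) * (x + - d)).
    rewrite -!sumrN -!big_split /=; apply: eq_bigr => x _.
    by rewrite /g !chiM // addr0; ring.
  rewrite !sum_chiD // !sum_chi2 //.
  have -> : \sum_(x : F) 1 = q by rewrite sumr_const.
  have := sum_chi3_le 0 d (- d); rewrite ler_norml => /andP[].
  by move: (\sum_x _) q Eq; clear; lia.
have [/existsP[x /and3P[/eqP x1 /eqP x2 /eqP x3]]|] :=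
  boolP [exists x, [&& chi F x == 1, chi F (x + d) == -1 & chi F (x - d) == -1]].
  by exists x.
rewrite negb_exists => /forallP none.
suff : \sum_x g x <= 24 by lia.
apply: (@le_trans _ _ (\sum_x ((x == 0)%:R * 8%:R + (x == - d)%:R * 8%:R + (x == d)%:R * 8%:R))).
  apply: ler_sum => x _; have := none x; rewrite /g.
  have := chi_eq0 F x; have := chi_eq0 F (x + d); have := chi_eq0 F (x - d).
  rewrite subr_eq0 addr_eq0.
  by case: (x == 0); case: (x == - d); case: (x == d);
  have [->|->|->] := chi_cases F x; have [->|->|->] := chi_cases F (x + d);
    have [->|->|->] := chi_cases F (x - d).
have ind y : \sum_x (x == y)%:R * 8%:R = 8%:R :> int.
  rewrite (bigD1 y) //= eqxx big1 ?addr0 // => x /negbTE ->.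
  by rewrite mul0r.
by rewrite !big_split /= !ind.
Qed.

End CharacterSums.

(** * Counting decompositions *)

Lemma sumsetC (F : finFieldType) (A B : {set F}) : sumset A B = sumset B A.
Proof.
by apply/setP => x; apply/imset2P/imset2P => -[a b Aa Bb ->];
  exists b a; rewrite // addrC.
Qed.

Lemma leq_card_sumset (F : finFieldType) (A B : {set F}) :
  (#|sumset A B| <= #|A| * #|B|)%N.
Proof. by rewrite /sumset curry_imset2X -cardsX leq_imset_card. Qed.

Lemma exists_nat_sqrt n : exists s, (s * s <= n < s.+1 * s.+1)%N.
Proof.
elim: n => [|n [s /andP[sn ns]]]; first by exists 0%N.
have [lt|ge] := ltnP n.+1 (s.+1 * s.+1); first by exists s; rewrite lt leqW.
by exists s.+1; rewrite ge /=; nia.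
Qed.

Lemma leq_bin_expn n k : ('C(n, k) <= n ^ k)%N.
Proof.
apply: (@leq_trans (n ^_ k)).
  by rewrite -bin_ffact leq_pmulr // fact_gt0.
elim: k n => [|k IH] n; first by rewrite ffactn0 expn0.
rewrite ffactnS expnS leq_mul2l (leq_trans (IH _)) ?orbT //.
by case: k {IH} => // k; rewrite leq_exp2r ?leq_pred.
Qed.

Section Decompositions.

Variables (F : finFieldType) (s : nat).
Hypotheses (oddF : odd #|F|) (sF : (s * s <= #|F| < s.+1 * s.+1)%N).
Implicit Types (A B : {set F}).
Let Q := nonzero_squares F.
Let E : int := 100 * s%:R.

Let s_gt0 : (0 < s)%N.
Proof.
by have := finNzRing_gt1 F; case/andP: sF => _; case: s => //; case: #|F| => [|[]].
Qed.

Let E_ge1 : 1 <= E. Proof. by rewrite /E; lia. Qed.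

Let cubic_le (u v w : F) :
  `|\sum_x chi F (x ^+ 3 + (u * x ^+ 2 + v * x + w))| <= E.
Proof. by case/andP: sF => s1 s2; apply: cubic_sum_bound. Qed.

(** With [A = {a, b}], each element of [A + B] has a neighbour in [A + B] at distance [b - a] on one
    side, which an isolated residue has not. *)
Let two_term_summand A B : sumset A B = Q -> #|A| = 2%N -> (s <= 101)%N.
Proof.
move=> ABQ /eqP/cards2P[a [b [ab Aab]]].
rewrite leqNgt; apply/negP => s_gt.
have [||r [r1 rD rB]] := @exists_isolated_residue F E oddF E_ge1 cubic_le (b - a).
- by rewrite subr_eq0 eq_sym.
- by rewrite /E; case/andP: sF => s1 _; move: s1 s_gt; nia.
have : r \in sumset A B by rewrite ABQ mem_nonzero_squares // r1.
case/imset2P => a' y a'A yB rE.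
have inQ x : x \in A -> chi F (x + y) = 1.
  by move=> xA; apply/eqP; rewrite -mem_nonzero_squares // -/Q -ABQ; apply: imset2_f.
move: a'A; rewrite Aab !inE => /orP[] /eqP a'E.
  have := inQ b; rewrite Aab !inE eqxx orbT => /(_ isT).
  suff -> : b + y = r + (b - a) by rewrite rD.
  by rewrite rE a'E; ring.
have := inQ a; rewrite Aab !inE eqxx => /(_ isT).
suff -> : a + y = r - (b - a) by rewrite rB.
by rewrite rE a'E; ring.
Qed.

(** Inserting [q <= 2 #|A| #|B| + 1] into [card_common_residues] leaves, for [k = #|A|], [q ((k +
    2)^2 - 2 (3 k + 2)) = q (k^2 - 2 k)] on the left. This is at least [q k^2 / 3] once [k >= 3] but
    vanishes at [k = 2], hence the separate case. *)
Lemma leq_sqrt_card_summand A B :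
  additively_decomposed Q A B -> (s <= 39 * 100 * #|A|)%N.
Proof.
rewrite /additively_decomposed leq_min => /and3P[/eqP/esym ABQ A2 B2].
have [Ale2|A3] := leqP #|A| 2.
  have s101 : (s <= 101)%N by apply: two_term_summand ABQ _; apply/eqP; rewrite eqn_leq Ale2.
  by apply: leq_trans s101 _; move: A2; lia.
have AB a b : a \in A -> b \in B -> chi F (b + a) = 1.
  move=> aA bB; apply/eqP; rewrite -mem_nonzero_squares // -/Q -ABQ addrC.
  exact: imset2_f.
have := @card_common_residues F E oddF E_ge1 cubic_le A B AB (ltnW A2).
have qAB : (#|F| <= (#|A| * #|B|).*2.+1)%N.
  rewrite card_odd_field // ltnS leq_double.
  by apply: leq_trans (leq_card_nonzero_squares F oddF) _; rewrite -/Q -ABQ leq_card_sumset.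
case/andP: sF => s1 _; move: qAB s1 A3; rewrite /E.
move: #|A| #|B| #|F| => k b q qAB s1 k3; rewrite !exprS expr0 !mulr1 => bnd.
have {}bnd : (b * (k * ((k + 2) * (k + 2))) <= q * (3 * k + 2) + 600 * s * (k * k * k))%N.
  by lia.
have h1 : (q * ((k + 2) * (k + 2))
    <= 2 * (q * (3 * k + 2) + 600 * s * (k * k * k)) + (k + 2) * (k + 2))%N.
  apply: leq_trans (leq_mul qAB (leqnn _)) _; rewrite -addn1 -muln2 mulnDl mul1n leq_add2r.
  by rewrite -[leqLHS]mulnA [leqLHS]mulnCA leq_mul2l /= (leq_trans _ bnd) //; lia.
have h2 : (q * (k * k) <= q * (3 * (k * k - 2 * k)))%N by rewrite leq_mul2l; apply/orP; right; nia.
have h3 : (q * (k * k - 2 * k) <= 1200 * s * (k * k * k) + (k + 2) * (k + 2))%N.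
  have : (2 * k <= k * k)%N by rewrite leq_mul2r (ltnW k3) orbT.
  by move: h1; nia.
have h4 : ((k + 2) * (k + 2) <= 3 * (k * k))%N by nia.
have h5 : (q * (k * k) <= (3600 * s * k + 9) * (k * k))%N by nia.
have h6 : (q <= 3600 * s * k + 9)%N by move: h5; rewrite leq_mul2r muln_eq0; move: k3; case: (k).
have h7 : (s * s <= 3609 * k * s)%N by nia.
by move: h7; rewrite leq_mul2r eqn0Ngt s_gt0 /=; lia.
Qed.

(** The largest set whose sum with [A] stays inside the squares: it contains every [B] with
    [A + B = Q]. *)
Definition residue_shifts A : {set F} := [set x | [forall a in A, chi F (x + a) == 1]].

(** With [k = #|A|], the main term is at most [5 q / k^2], and [k^2 > s] makes it at most [10 s];
    the error term adds [600 s]. *)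
Lemma card_residue_shifts A : (s < #|A| ^ 2)%N ->
  (#|residue_shifts A| <= 610 * s)%N.
Proof.
move=> sA; have A0 : (0 < #|A|)%N by case: #|A| sA.
have sub a b : a \in A -> b \in residue_shifts A -> chi F (b + a) = 1.
  by move=> aA; rewrite inE => /forall_inP/(_ a aA)/eqP.
have bnd := @card_common_residues F E oddF E_ge1 cubic_le A (residue_shifts A) sub A0.
case/andP: sF => _ qs; move: bnd sA A0 qs s_gt0; rewrite /E -mulnn.
move: #|A| #|residue_shifts A| #|F| => k b q; rewrite !exprS expr0 !mulr1 => bnd sk k0 qs s0.
have {}bnd : (b * (k * ((k + 2) * (k + 2))) <= q * (3 * k + 2) + 600 * s * (k * k * k))%N.
  by lia.
have k3 : (0 < k * k * k)%N by rewrite !muln_gt0 k0.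
suff : (b * (k * k * k) <= 610 * s * (k * k * k))%N by rewrite leq_pmul2r.
have qk : (q <= s.+1 * (k * k))%N by apply: leq_trans (ltnW qs) _; rewrite leq_mul2l sk orbT.
have h1 : (q * (3 * k + 2) <= s.+1 * (k * k) * (5 * k))%N by apply: leq_mul => //; lia.
have h2 : (s.+1 * (k * k) * (5 * k) <= 10 * s * (k * k * k))%N.
  rewrite [leqLHS](_ : _ = s.+1 * 5 * (k * k * k))%N; last by lia.
  by rewrite leq_mul2r; apply/orP; right; lia.
have h3 : (b * (k * k * k) <= b * (k * ((k + 2) * (k + 2))))%N.
  by rewrite leq_mul2l; apply/orP; right; nia.
by lia.
Qed.

(** Here [t] is about [q^(1/4)]. Since [s >= t^2 > 3900 t], every [A] has more than [t] elements; a
    subset of size [t + 1] already confines [B] to at most [610 s] elements. *)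
Lemma card_summands (t : nat) :
  (39 * 100 < t)%N -> (t * t <= s < t.+1 * t.+1)%N ->
  (#|[set B | [exists A, additively_decomposed Q A B]]| <= #|F| ^ t.+1 * 2 ^ (610 * s))%N.
Proof.
move=> t_gt /andP[ts st].
pose S := [set A : {set F} | #|A| == t.+1].
have sub : [set B | [exists A, additively_decomposed Q A B]]
    \subset \bigcup_(A in S) powerset (residue_shifts A).
  apply/subsetP => B; rewrite inE => /existsP[A dAB].
  have tA : (t < #|A|)%N.
    have := leq_sqrt_card_summand _ _ dAB; rewrite ltnNge; apply: contraTN => At.
    rewrite -ltnNge; apply: leq_trans ts.
    by rewrite (leq_ltn_trans (leq_mul (leqnn _) At)) // ltn_mul2r t_gt (leq_trans _ t_gt).
  have [A' A'A cA'] : exists2 A' : {set F}, A' \subset A & #|A'| = t.+1.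
    exists [set x in take t.+1 (enum A)].
      by apply/subsetP => x; rewrite inE => /mem_take; rewrite mem_enum.
    rewrite cardsE; have /card_uniqP -> := take_uniq t.+1 (enum_uniq A).
    by rewrite size_takel // -cardE.
  apply/bigcupP; exists A'; first by rewrite inE cA'.
  rewrite powersetE; apply/subsetP => b bB; rewrite inE.
  apply/forall_inP => a aA'; rewrite -mem_nonzero_squares //.
  case/andP: dAB; rewrite -/Q => /eqP -> _; rewrite addrC.
  by apply: imset2_f => //; apply: (subsetP A'A).
apply: leq_trans (subset_leq_card sub) _.
apply: (@leq_trans (\sum_(A in S) #|powerset (residue_shifts A)|)).
  apply: (big_ind2 (fun (X : {set {set F}}) n => #|X| <= n)%N) => // [|X m Y n Xm Yn].
    by rewrite cards0.
  exact: leq_trans (leq_card_setU _ _) (leq_add Xm Yn).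
apply: (@leq_trans (\sum_(A in S) 2 ^ (610 * s))).
  apply: leq_sum => A; rewrite inE => /eqP cA.
  by rewrite card_powerset leq_exp2l // card_residue_shifts // cA -mulnn.
by rewrite sum_nat_const leq_mul2r /S card_draws leq_bin_expn orbT.
Qed.

(** By commutativity both summands range over the same set. *)
Lemma num_decompositions_le_sqr :
  (num_decompositions F <= #|[set B | [exists A, additively_decomposed Q A B]]| ^ 2)%N.
Proof.
rewrite -mulnn -cardsX subset_leq_card //; apply/subsetP => -[A B].
rewrite !inE /= => dAB; apply/andP; split; apply/existsP; last by exists A.
by exists B; rewrite /additively_decomposed sumsetC minnC.
Qed.

End Decompositions.

(** * Conversion to the exponential bound *)

Lemma natr_le_expR (R : realType) (n : nat) : n%:R <= expR n%:R :> R.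
Proof. by apply: le_trans (expR_ge1Dx _); rewrite lerDr. Qed.

Lemma expr2n_le_expR (R : realType) (n : nat) : 2%:R ^+ n <= expR n%:R :> R.
Proof.
rewrite -[n%:R]mulr1 expRM_natl lerXn2r ?nnegrE ?expR_ge0 //.
by have := expR_ge1Dx (1 : R); rewrite -[2%:R]/(1 + 1).
Qed.

Theorem theorem1p1 (R : realType) :
  exists C : R, 0 < C /\
    forall F : finFieldType, odd #|F| ->
      (num_decompositions F)%:R <= expR (C * Num.sqrt (#|F|%:R)).
Proof.
pose K := (39 * 100)%N.
(* The first term serves [t <= K]; [1252 = 2 (16 + 610)] serves [t > K], through
   [(t + 1)^2 <= 4 s]. *)
pose K2 := (8 * (K.+1 * K.+1) + 1252)%N.
exists K2%:R; split; first by rewrite ltr0n /K2 addn_gt0 orbT.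
move=> F oddF; have [s sF] := exists_nat_sqrt #|F|; have [t ts] := exists_nat_sqrt s.
suff [e le1 le2] : exists2 e : nat,
    (num_decompositions F)%:R <= expR e%:R :> R & (e <= K2 * s)%N.
  apply: le_trans le1 _; rewrite ler_expR.
  apply: (@le_trans _ _ (K2%:R * s%:R)); first by rewrite -natrM ler_nat.
  rewrite ler_wpM2l // -[s%:R]gtr0_norm ?ltr0n.
    by rewrite -sqrtr_sqr ler_sqrt // -natrX ler_nat -mulnn; case/andP: sF.
  by have := finNzRing_gt1 F; case/andP: sF => _; case: (s) => //; case: #|F| => [|[]].
(* For [t <= K] the field has bounded size, and counting all [2^(2 q)] pairs of subsets suffices. *)
have [tK|tK] := leqP t K.
  exists (#|F| + #|F|)%N; last first.
    case/andP: sF => _ Fs; case/andP: ts => _ st.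
    have sK : (s.+1 <= K.+1 * K.+1)%N by apply: leq_trans st (leq_mul _ _).
    have s0 : (0 < s)%N.
      by move: Fs (finNzRing_gt1 F); case: (s) => //; case: #|F| => [|[]].
    have h : (s.+1 * s.+1 <= K.+1 * K.+1 * (2 * s))%N by apply: leq_mul => //; lia.
    rewrite /K2; move: (K.+1 * K.+1)%N h => L h; lia.
  apply: le_trans (expr2n_le_expR _ _); rewrite -natrX ler_nat.
  have cardP : #|{set F}| = (2 ^ #|F|)%N.
    by rewrite -cardsT -[in RHS]cardsT -card_powerset powersetT.
  by apply: leq_trans (max_card _) _; rewrite card_prod cardP expnD.
have t0 : (0 < t)%N by apply: leq_trans tK.
exists (2 * (4 * t.+1 * t.+1 + 610 * s))%N; last first.
  have : (t.+1 * t.+1 <= 4 * s)%N.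
    by case/andP: ts => h _; move: h t0; clear; nia.
  by rewrite /K2; move: (K.+1 * K.+1)%N => L; clear; nia.
have := card_summands F s oddF sF t tK ts.
have := num_decompositions_le_sqr F; set N := #|_| => le1 le2.
(* Gives [q^(t + 1) <= (t + 1)^(4 (t + 1)) <= exp (4 (t + 1)^2)], which is [exp (O(s))]. *)
have Fk : (#|F| <= t.+1 ^ 4)%N.
  case/andP: sF => _ /ltnW/leq_trans; apply; rewrite -[4%N]/(2 * 2)%N expnM -!mulnn.
  by apply: leq_mul; case/andP: ts.
have e1 : #|F|%:R ^+ t.+1 <= expR (4 * t.+1 * t.+1)%N%:R :> R.
  rewrite natrM mulrC expRM_natl lerXn2r ?nnegrE ?expR_ge0 //.
  rewrite natrM expRM_natl; apply: (@le_trans _ _ (t.+1%:R ^+ 4)); first by rewrite -natrX ler_nat.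
  by rewrite lerXn2r ?nnegrE ?expR_ge0 // natr_le_expR.
apply: (@le_trans _ _ ((#|F|%:R ^+ t.+1 * 2%:R ^+ (610 * s)) ^+ 2)).
  rewrite -!natrX -natrM -natrX ler_nat.
  by apply: leq_trans le1 _; rewrite leq_exp2r.
rewrite natrM expRM_natl lerXn2r ?nnegrE ?expR_ge0 //.
  by rewrite mulr_ge0 ?exprn_ge0.
rewrite natrD expRD ler_pM ?exprn_ge0 //.
exact: expr2n_le_expR.
Qed.
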